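(* Let $\Omega\subset\mathbb{R}^d$ ($d=2,3$) be a rectangular box with periodic boundary conditions, let $\nu>0$ and $\gamma>0$, and let $\bm F\in L^\infty(0,\infty;\bm H)$. Let $0=t_0<t_1<t_2<\cdots$ be an arbitrary sequence of time nodes with step sizes $\tau_k=t_k-t_{k-1}>0$ (no restriction on the step sizes or their ratios). Assume $(\bm u^i,r^i)\in\big((\dot H^\alpha_{\mathrm{per}}(\Omega))^d\cap\bm H\big)\times\mathbb{R}$ for $i=0,1$ with $\alpha\ge \tfrac34$, and let $(\bm u^{n},r^{n})_{n\ge 0}$ be generated by the ETD-mr-SAV-MS2o scheme: for every $n\ge1$, $$\bm u^{n+1}=\varphi_0(\tau_{n+1}\nu\mathcal L)\bm u^n-\tau_{n+1}\big(1-(r^{n+1})^2\big)\varphi_1(\tau_{n+1}\nu\mathcal L)B(\tilde{\bm u}^{n+\frac12},\tilde{\bm u}^{n+\frac12})+\tau_{n+1}\varphi_1(\tau_{n+1}\nu\mathcal L)\bm F^{n+\frac12},$$ $$r^{n+1}=\varphi_0(\tau_{n+1}\gamma)r^n+\tau_{n+1}(1-r^{n+1})\big\langle\varphi_1(\tau_{n+1}\nu\mathcal L)B(\tilde{\bm u}^{n+\frac12},\tilde{\bm u}^{n+\frac12}),\bm u^{n+1}\big\rangle,$$ where $\tilde{\bm u}^{n+\frac12}=\frac{\tau_{n+1}+2\tau_n}{2\tau_n}\bm u^n-\frac{\tau_{n+1}}{2\tau_n}\bm u^{n-1}$ and $\bm F^{n+\frac12}=\bm F(t_n+\tfrac12\tau_{n+1})$.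 Set $\theta:=\min\{\nu\lambda_1,\gamma\}>0$. Then for all $n\ge1$, $$\|\bm u^{n+1}\|^2+|r^{n+1}+1|^2\le e^{-\theta\sum_{i=1}^n\tau_{i+1}}\big(\|\bm u^1\|^2+|r^1+1|^2\big)+\frac1\theta\Big(\frac{1}{\nu\lambda_1}\|\bm F\|^2_{L^\infty(0,\infty;\bm H)}+\gamma\Big).$$
   Context: $\|\cdot\|$ denotes the $L^2(\Omega)$ norm and $\langle\cdot,\cdot\rangle$ the $L^2$ inner product (extended to the duality pairing between $\dot H^1_{\mathrm{per}}$ and $H^{-1}_{\mathrm{per}}$). $(\dot H^k_{\mathrm{per}}(\Omega))^d$ is the closure in $(H^k(\Omega))^d$ of the $d$-dimensional zero-mean trigonometric polynomials; $\bm H=\{\bm u\in(\dot H^0_{\mathrm{per}}(\Omega))^d:\nabla\cdot\bm u=0\}$ and $\bm V=\{\bm u\in(\dot H^1_{\mathrm{per}}(\Omega))^d:\nabla\cdot\bm u=0\}$. $\mathcal P$ is the Leray–Hopf orthogonal projection of zero-mean $L^2$ vector fields onto $\bm H$; $\mathcal L=-\mathcal P\Delta$ is the Stokes operator, with smallest eigenvalue $\lambda_1>0$; $B(\bm u,\bm v)=\mathcal P(\bm u\cdot\nabla\bm v)$. The scalar functions are $\varphi_0(z)=e^{-z}$ and $\varphi_1(z)=(1-e^{-z})/z$ (with $\varphi_1(0)=1$); $\varphi_j(\tau\nu\mathcal L)$ is defined spectrally, i.e. acting on each divergence-free Fourier mode $\hat{\bm h}_{\bm k}e^{i\bm k\cdot\bm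 x}$ ($\bm k\ne0$) by multiplication with $\varphi_j(\tau\nu\lambda_{\bm k})$, where $\lambda_{\bm k}$ is the corresponding Stokes eigenvalue.
   Formalization: Since F is evaluated at the midpoints, F is taken as a genuine function with F(s) in H for every s>0, and its L^∞(0,∞;H) norm is the supremum of ‖F(s)‖ over all s>0 instead of the essential supremum, for which the point values are undefined. *)

(* Defs.v *)
From HB Require Import structures.
From mathcomp Require Import all_boot all_order all_algebra.
From mathcomp Require Import all_classical all_reals all_analysis.
From mathcomp Require Import complex.

Set Implicit Arguments.
Unset Strict Implicit.
Unset Printing Implicit Defensive.
Import Order.TTheory GRing.Theory Num.Theory.

Local Open Scope classical_set_scope.
Local Open Scope ring_scope.
Local Open Scope complex_scope.

Section Torus.
Context {R : realType} (d : nat).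

Definition mode := {ffun 'I_d -> int}.
Definition mode0 : mode := [ffun=> 0%Z].
Definition mode_sub (k j : mode) : mode := [ffun c => (k c - j c)%R].
Definition mode_opp (k : mode) : mode := [ffun c => (- k c)%R].

(* a (possibly complex) d-vector field on Omega, given by its Fourier
   coefficients:  u(x) = sum_n  u n  e^{i k_n . x}  *)
Definition vfield := mode -> 'I_d -> R[i].

Definition sqabs (z : R[i]) : R := complex.Re z ^+ 2 + complex.Im z ^+ 2.

(* signed sum over a countable family (Lebesgue-style: positive part minus
   negative part; the true sum for absolutely summable families) *)
Definition ssum (T : choiceType) (f : T -> R) : R :=
  fine (\esum_(x in [set: T]) (Num.max (f x) 0)%:E)%E
  - fine (\esum_(x in [set: T]) (Num.max (- f x) 0)%:E)%E.

Definition csum (T : choiceType) (f : T -> R[i]) : R[i] :=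
  (ssum (fun x => complex.Re (f x))) +i* (ssum (fun x => complex.Im (f x))).

Section Box.
Variable L : 'I_d -> R.  (* side lengths of Omega = prod_c [0, L c] *)

Definition vol : R := \prod_c L c.

(* wave vector k_n and Stokes eigenvalue lambda_n = |k_n|^2 of mode n *)
Definition wv (n : mode) (c : 'I_d) : R := 2 * pi * (n c)%:~R / L c.
Definition lam (n : mode) : R := \sum_c wv n c ^+ 2.

Definition lambda1 : R := inf [set lam n | n in [set n : mode | n != mode0]].

(* squared L^2(Omega) norm (Parseval), as an extended real *)
Definition sqnorm (u : vfield) : \bar R :=
  (vol%:E * \esum_(n in [set: mode]) (\sum_c sqabs (u n c))%:E)%E.

(* L^2 norm as a real number (meaningful for u in L^2) *)
Definition l2norm (u : vfield) : R := Num.sqrt (fine (sqnorm u)).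

Definition inner (u v : vfield) : R :=
  vol * ssum (fun n => \sum_c complex.Re (u n c * conjc (v n c))).

Definition real_valued (u : vfield) : Prop :=
  forall n c, u (mode_opp n) c = conjc (u n c).
Definition zero_mean (u : vfield) : Prop := forall c, u mode0 c = 0.
Definition div_free (u : vfield) : Prop :=
  forall n, \sum_c (wv n c)%:C * u n c = 0.
Definition in_L2 (u : vfield) : Prop :=
  (\esum_(n in [set: mode]) (\sum_c sqabs (u n c))%:E < +oo)%E.

Definition in_Hdot (a : R) (u : vfield) : Prop :=
  [/\ real_valued u, zero_mean u &
   (\esum_(n in [set: mode]) (((1 + lam n) `^ a) * \sum_c sqabs (u n c))%:E
     < +oo)%E].

Definition in_H (u : vfield) : Prop :=
  [/\ real_valued u, zero_mean u, div_free u & in_L2 u].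

Definition leray_mode (n : mode) (v : 'I_d -> R[i]) (c : 'I_d) : R[i] :=
  if lam n == 0 then 0
  else v c - (wv n c)%:C * (\sum_c' (wv n c')%:C * v c') / (lam n)%:C.

(* B(u,v) = P (u . grad v), written in divergence form P div(u (x) v)
   (valid for div-free u), Fourier side:
   (u.grad v)^_n = i sum_j (k_n . u_j) v_{n-j} *)
Definition Bop (u v : vfield) : vfield := fun n =>
  leray_mode n (fun c => 'i * csum (fun j : mode =>
      (\sum_c' (wv n c')%:C * u j c') * v (mode_sub n j) c)).

Definition specL (f : R -> R) (s : R) (u : vfield) : vfield :=
  fun n c => (f (s * lam n))%:C * u n c.

End Box.
End Torus.

Definition phi0 {R : realType} (z : R) : R := expR (- z).
Definition phi1 {R : realType} (z : R) : R :=
  if z == 0 then 1 else (1 - expR (- z)) / z.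

(* Main.v *)
(* Pairing the velocity equation with u^{n+1} and adding 1 + r^{n+1} times the
   equation for r^{n+1} cancels the nonlinear terms, both equations containing
   the same number <phi_1 B, u^{n+1}>.  With E_n = ||u^n||^2 + (r^n + 1)^2 and
   eps = exp(- theta tau_{n+1}), Young's inequality on each Fourier mode leaves
   E_{n+1} <= eps E_n + (1 - eps) C, where C is the last term of the bound.

   The pairing must converge and u^{n+1} must be in L^2; both follow from the
   propagation of H^{3/4} regularity.  With q_k = (1 + lambda_k)^{1/8} the
   squared H^{3/4} norm is sum_k q_k^6 |u_k|^2, and as phi_1 gains two
   derivatives, one step is controlled by sum_k q_k^{-2} ((a * a) k)^2, where
   a_k = |u_k|.  This is finite in dimension at most 3 because
   sum_k q_k^{-14} is. *)
Require Import Defs.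
From HB Require Import structures.
From mathcomp Require Import all_boot all_order all_algebra.
From mathcomp Require Import all_classical all_reals all_analysis.
From mathcomp Require Import complex.
From mathcomp Require Import ring lra.
Import Order.TTheory GRing.Theory Num.Theory.
Local Open Scope classical_set_scope.
Local Open Scope ring_scope.
Local Open Scope complex_scope.

(** * Sums of nonnegative families *)

Section NonnegativeSums.
Context {R : realType}.

(** [fine] sends +oo to 0, so for a nonnegative family this is the true sum only under
    [nnsummable]. *)
Definition nnsum {T : choiceType} (f : T -> R) : R :=
  fine (\esum_(x in [set: T]) (f x)%:E)%E.

Definition nnsummable {T : choiceType} (f : T -> R) : Prop :=
  (forall x, 0 <= f x) /\ (\esum_(x in [set: T]) (f x)%:E < +oo)%E.

Lemma nnsumE {T : choiceType} (f : T -> R) : nnsummable f ->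
  (\esum_(x in [set: T]) (f x)%:E)%E = (nnsum f)%:E.
Proof.
move=> [f0 fy]; rewrite fineK// ge0_fin_numE//.
by apply: esum_ge0 => x _; rewrite lee_fin.
Qed.

Lemma nnsum_ge0 {T : choiceType} (f : T -> R) : (forall x, 0 <= f x) ->
  0 <= nnsum f.
Proof. by move=> f0; apply/fine_ge0/esum_ge0 => x _; rewrite lee_fin. Qed.

Lemma nnsummable_le {T : choiceType} (f g : T -> R) :
  (forall x, 0 <= f x <= g x) -> nnsummable g -> nnsummable f.
Proof.
move=> fg [_ gy]; split; first by move=> x; case/andP: (fg x).
by apply: le_lt_trans gy; apply: le_esum => x _; rewrite lee_fin; case/andP: (fg x).
Qed.

Lemma nnsum_le {T : choiceType} (f g : T -> R) :
  (forall x, 0 <= f x <= g x) -> nnsummable g -> nnsum f <= nnsum g.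
Proof.
move=> fg gs; rewrite -lee_fin -!nnsumE//; last exact: nnsummable_le gs.
by apply: le_esum => x _; rewrite lee_fin; case/andP: (fg x).
Qed.

Lemma nnsum_esumD {T : choiceType} {f g : T -> R} :
  nnsummable f -> nnsummable g ->
  (\esum_(x in [set: T]) (f x + g x)%:E)%E = (nnsum f + nnsum g)%:E.
Proof.
move=> fs gs; rewrite EFinD -!nnsumE// -esumD//.
by move=> x _; rewrite lee_fin fs.1.
by move=> x _; rewrite lee_fin gs.1.
Qed.

Lemma nnsummableD {T : choiceType} (f g : T -> R) :
  nnsummable f -> nnsummable g -> nnsummable (fun x => f x + g x).
Proof.
move=> fs gs; split=> [x|]; first by rewrite addr_ge0 ?fs.1 ?gs.1.
by rewrite (nnsum_esumD fs gs) ltry.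
Qed.

Lemma nnsumD {T : choiceType} (f g : T -> R) :
  nnsummable f -> nnsummable g ->
  nnsum (fun x => f x + g x) = nnsum f + nnsum g.
Proof. by move=> fs gs; rewrite /nnsum (nnsum_esumD fs gs). Qed.

Lemma esum_leZ {T : choiceType} (c : R) (f : T -> R) : 0 <= c ->
  nnsummable f ->
  (\esum_(x in [set: T]) (c * f x)%:E <= (c * nnsum f)%:E)%E.
Proof.
move=> c0 fs; apply: ge_ereal_sup => _ [X [finX _]] <-.
rewrite fsumEFin// lee_fin -mulr_fsumr ler_wpM2l//.
rewrite -lee_fin -nnsumE// -fsumEFin//.
by apply: ereal_sup_ubound; exists X.
Qed.

Lemma nnsummableZ {T : choiceType} (c : R) (f : T -> R) : 0 <= c ->
  nnsummable f -> nnsummable (fun x => c * f x).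
Proof.
move=> c0 fs; split=> [x|]; first by rewrite mulr_ge0 ?fs.1.
by apply: le_lt_trans (ltry (c * nnsum f)); exact: esum_leZ.
Qed.

(** [esum_leZ] gives one inequality; applied to c^-1 and the family c f it gives the other. *)
Lemma nnsumZ {T : choiceType} (c : R) (f : T -> R) : 0 <= c ->
  nnsummable f -> nnsum (fun x => c * f x) = c * nnsum f.
Proof.
move=> c0 fs; have cfs := nnsummableZ _ _ c0 fs.
have le k (g : T -> R) : 0 <= k -> nnsummable g ->
    nnsum (fun x => k * g x) <= k * nnsum g.
  move=> k0 gs; rewrite -lee_fin -nnsumE ?esum_leZ//; exact: nnsummableZ.
have [->|cn0] := eqVneq c 0.
  rewrite mul0r /nnsum esum1// => x _; by rewrite mul0r.
apply/le_anti; rewrite le//= -ler_pdivlMl ?lt0r ?cn0//.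
apply: le_trans (le _ _ _ cfs); last by rewrite invr_ge0.
rewrite le_eqVlt; apply/orP; left; apply/eqP; congr (nnsum _).
by apply/funext => x; rewrite mulKf.
Qed.

Lemma ler_nnsum {T : choiceType} (f : T -> R) x : nnsummable f -> f x <= nnsum f.
Proof.
move=> fs; rewrite -lee_fin -nnsumE//.
rewrite -(@esum_set1 _ _ x (fun y => (f y)%:E)) ?lee_fin ?fs.1//.
rewrite esum_mkcond; apply: le_esum => y _; case: ifP => // _.
by rewrite lee_fin fs.1.
Qed.

Lemma nnsum_reindex {T T' : choiceType} (h : T -> T') (f : T' -> R) :
  bijective h -> nnsum (fun x => f (h x)) = nnsum f.
Proof.
move=> bh; rewrite /nnsum -(reindex_esum setT setT h (fun y => (f y)%:E))//.
by rewrite setTT_bijective.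
Qed.

Lemma nnsummable_reindex {T T' : choiceType} (h : T -> T') (f : T' -> R) :
  bijective h -> nnsummable f -> nnsummable (fun x => f (h x)).
Proof.
move=> bh [f0 fy]; split=> //; rewrite -(reindex_esum setT setT h (fun y => (f y)%:E))//.
by rewrite setTT_bijective.
Qed.

Lemma esum_exchange {T T' : choiceType} (a : T -> T' -> \bar R) :
  (forall i j, 0 <= a i j)%E ->
  (\esum_(i in [set: T]) \esum_(j in [set: T']) a i j =
   \esum_(j in [set: T']) \esum_(i in [set: T]) a i j)%E.
Proof.
move=> a0; rewrite !esum_esum//.
rewrite (reindex_esum ([set: T'] `*`` (fun=> [set: T])) _ (fun x => (x.2, x.1)))//.
split=> //=; first by move=> [i1 i2] [j1 j2] /= _ _ [] -> ->.
by move=> [i j] _ /=; exists (j, i).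
Qed.

(** Tonelli. Convergence of each row keeps its [nnsum] from being the default value 0 of a divergent
    series. *)
Lemma nnsummable_exchange {T T' : choiceType} (a : T -> T' -> R) :
  (forall i j, 0 <= a i j) ->
  (forall j, nnsummable (a^~ j)) -> nnsummable (fun j => nnsum (a^~ j)) ->
  (forall i, nnsummable (a i)) -> nnsummable (fun i => nnsum (a i)).
Proof.
move=> a0 sj sjs si; split=> [i|]; first exact: nnsum_ge0.
under eq_esum do rewrite -nnsumE//.
rewrite esum_exchange => [|i j]; last by rewrite lee_fin.
under eq_esum do rewrite nnsumE//.
exact: sjs.2.
Qed.

End NonnegativeSums.

(** * Convolutions of square-summable families and Young's inequality *)

Section Convolution.
Context {R : realType} {T : zmodType}.
Implicit Types f g : T -> R.

Lemma nnsummable_convM f g k :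
  nnsummable (fun j => f j ^+ 2) -> nnsummable (fun j => g j ^+ 2) ->
  (forall j, 0 <= f j) -> (forall j, 0 <= g j) ->
  nnsummable (fun j => f j * g (k - j)).
Proof.
move=> f2 g2 f0 g0.
apply: (@nnsummable_le _ _ _ (fun j => f j ^+ 2 + g (k - j) ^+ 2)).
  move=> j; rewrite mulr_ge0//=; have := f0 j; have := g0 (k - j); nra.
apply: nnsummableD => //.
apply: (nnsummable_reindex (fun j => k - j) (fun i => g i ^+ 2)) => //.
by exists (fun j => k - j) => j; rewrite subKr.
Qed.

(** Young's inequality: convolution with an l^1 family preserves l^2. Cauchy-Schwarz with weight g
    bounds the square of the convolution by a multiple of the convolution [W] of g with f^2, and
    Tonelli makes [W] summable. *)
Lemma nnsummable_young g f :
  nnsummable g -> nnsummable (fun j => f j ^+ 2) ->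
  (forall j, 0 <= f j) ->
  nnsummable (fun k => nnsum (fun j => g j * f (k - j)) ^+ 2).
Proof.
move=> gs f2 f0.
have g0 := gs.1.
set M := nnsum (fun j => f j ^+ 2); set G := nnsum g.
have M0 : 0 <= M by apply: nnsum_ge0 => j; exact: sqr_ge0.
have G0 : 0 <= G by apply: nnsum_ge0.
have bj j : bijective (fun k : T => k - j).
  by exists (fun k => k + j) => k; rewrite ?subrK ?addrK.
pose W k := nnsum (fun j => g j * f (k - j) ^+ 2).
(* Every value of f^2 is at most [M], so the series is dominated by [M] times g. *)
have sW k : nnsummable (fun j => g j * f (k - j) ^+ 2).
  apply: nnsummable_le (nnsummableZ M _ M0 gs) => j; rewrite mulr_ge0 ?sqr_ge0//=.
  by rewrite mulrC ler_wpM2r//; apply: (ler_nnsum (fun j => f j ^+ 2)).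
have WS : nnsummable W.
  apply: (nnsummable_exchange (fun k j => g j * f (k - j) ^+ 2)) => //.
  - by move=> k j; rewrite mulr_ge0 ?sqr_ge0.
  - move=> j; apply: nnsummableZ => //.
    exact: (nnsummable_reindex (fun k => k - j) (fun i => f i ^+ 2)).
  - have -> : (fun j => nnsum (fun k => g j * f (k - j) ^+ 2)) = (fun j => M * g j).
      apply/funext => j; rewrite nnsumZ//; last first.
        exact: (nnsummable_reindex (fun k => k - j) (fun i => f i ^+ 2)).
      by rewrite (nnsum_reindex (fun k => k - j) (fun i => f i ^+ 2))// mulrC.
    exact: nnsummableZ.
have G1 : 0 < G + 1 by rewrite ltr_wpDl.
apply: (nnsummable_le _ _ _ (nnsummableZ (G + 1) _ (ltW G1) WS)) => k.
rewrite sqr_ge0/=.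
set H := nnsum _.
have H0 : 0 <= H by apply: nnsum_ge0 => j; rewrite mulr_ge0.
have W0 : 0 <= W k by apply: WS.1.
have [->|Hn0] := eqVneq H 0; first by rewrite expr0n mulr_ge0// ltW.
have Hgt0 : 0 < H by rewrite lt0r Hn0.
(* AM-GM with weight t gives H^2 <= (G + 1) W k; using G + 1 instead of G
   avoids a division by 0 when g = 0. *)
pose t := H / (G + 1); have t0 : 0 < t by rewrite divr_gt0.
have t20 : 0 <= t / 2 by rewrite divr_ge0// ltW.
have t21 : 0 <= (2 * t)^-1 by rewrite invr_ge0 mulr_ge0// ltW.
have key : H <= t / 2 * G + (2 * t)^-1 * W k.
  have s1 := nnsummableZ _ _ t20 gs; have s2 := nnsummableZ _ _ t21 (sW k).
  rewrite -[X in X + _]nnsumZ// -[X in _ + X]nnsumZ// -nnsumD//.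
  apply: nnsum_le => [j|]; last exact: nnsummableD.
  rewrite mulr_ge0//= -subr_ge0.
  rewrite (_ : _ - _ = (2 * t)^-1 * (g j * (t - f (k - j)) ^+ 2)).
    by rewrite mulr_ge0// mulr_ge0// sqr_ge0.
  by field; rewrite gt_eqF.
have t2 : 0 < 2 * t by rewrite mulr_gt0.
have {}key : 2 * t * H <= t ^+ 2 * G + W k.
  rewrite -(ler_pM2l t2) in key; apply: le_trans key _.
  rewrite (_ : 2 * t * _ = t ^+ 2 * G + W k)//.
  by field; rewrite gt_eqF.
have HtG : H = t * (G + 1) by rewrite mulfVK// gt_eqF.
have aux (x y w : R) : 2 * x * (x * (y + 1)) <= x ^+ 2 * y + w ->
    x ^+ 2 * (y + 1) <= w by have := sqr_ge0 x; lra.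
have : t ^+ 2 * (G + 1) <= W k by apply: aux; rewrite -HtG.
rewrite -(ler_pM2l G1); apply: le_trans; rewrite [in leLHS]HtG.
by rewrite (_ : (G + 1) * _ = (t * (G + 1)) ^+ 2)//; ring.
Qed.

End Convolution.

(** * The weighted convolution estimate *)

Section WeightedConvolution.
Context {R : realType} {T : zmodType}.

(* Low-high and high-low interactions give the last two terms, the remaining
   ones, with x and y both at least z / 2, give the first. *)
Lemma weight_split (x y z : R) : 1 <= x -> 1 <= y -> 1 <= z ->
  (z <= 2 * x) || (z <= 2 * y) ->
  1 <= 64 * z * (x ^+ 3 * y ^+ 3 / z ^+ 7 + y ^+ 3 / x ^+ 4 + x ^+ 3 / y ^+ 4).
Proof.
move=> x1 y1 z1 zxy.
have x0 : 0 < x by lra. have y0 : 0 < y by lra. have z0 : 0 < z by lra.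
have h (u v : R) : 0 < u -> 0 < v -> 2 * u <= z -> z <= 2 * v ->
    1 <= 64 * z * (v ^+ 3 / u ^+ 4).
  move=> u0 v0 uz zv; rewrite mulrA ler_pdivlMr ?exprn_gt0// mul1r.
  have A : (2 * u) ^+ 4 <= z ^+ 4 by rewrite lerXn2r// ?nnegrE ltW ?mulr_gt0.
  have B : z ^+ 3 <= (2 * v) ^+ 3 by rewrite lerXn2r// ?nnegrE ltW ?mulr_gt0.
  have C : z ^+ 4 <= 8 * (z * v ^+ 3).
    rewrite exprS (_ : 8 * _ = z * (2 * v) ^+ 3); last by ring.
    by rewrite ler_pM2l.
  have D : (2 * u) ^+ 4 = 16 * u ^+ 4 by ring.
  have E : 0 <= z * v ^+ 3 by rewrite mulr_ge0 ?exprn_ge0 ?ltW.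
  lra.
have t1 : 0 <= 64 * z * (x ^+ 3 * y ^+ 3 / z ^+ 7).
  by rewrite !mulr_ge0 ?invr_ge0 ?exprn_ge0// ltW.
have t2 : 0 <= 64 * z * (y ^+ 3 / x ^+ 4).
  by rewrite !mulr_ge0 ?invr_ge0 ?exprn_ge0// ltW.
have t3 : 0 <= 64 * z * (x ^+ 3 / y ^+ 4).
  by rewrite !mulr_ge0 ?invr_ge0 ?exprn_ge0// ltW.
rewrite !(mulrDr (64 * z)).
have [zx|xz] := leP z (2 * x); last first.
  by have := h x y x0 y0 (ltW xz); move: zxy; rewrite leNgt xz/= => zy /(_ zy); lra.
have [zy|yz] := leP z (2 * y); last by have := h y x y0 x0 (ltW yz) zx; lra.
(* Both ratios [2 * x / z] and [2 * y / z] are at least 1; their six factors of 2 give the constant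
   64. *)
suff : 1 <= 64 * z * (x ^+ 3 * y ^+ 3 / z ^+ 7) by lra.
rewrite (_ : _ * _ = (2 * x / z) ^+ 3 * (2 * y / z) ^+ 3); last first.
  by field; rewrite gt_eqF.
by rewrite mulr_ege1// exprn_ege1// ler_pdivlMr// mul1r.
Qed.

Variables (q a : T -> R).
Hypothesis q1 : forall k, 1 <= q k.
Hypothesis qD : forall j k, (q k <= 2 * q j) || (q k <= 2 * q (k - j)).
Hypothesis a0 : forall k, 0 <= a k.
Hypothesis qs : nnsummable (fun k => (q k ^+ 14)^-1).
Hypothesis qas : nnsummable (fun k => q k ^+ 6 * a k ^+ 2).

Let q0 k : 0 < q k. Proof. exact: lt_le_trans ltr01 (q1 k). Qed.

Lemma nnsummable_sqr_of_weighted : nnsummable (fun k => a k ^+ 2).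
Proof.
apply: nnsummable_le qas => k; rewrite sqr_ge0/=.
by rewrite ler_peMl ?sqr_ge0// exprn_ege1.
Qed.

(** [b] is square-summable, and [g], which is q^-7 b, is summable because q^-14 is. By
    [weight_split], q^-1 times the convolution of a with itself is at most a multiple of q^-7 (b
    conv b) + 2 (g conv b). In the first term b conv b is bounded by [M] and q^-7 is
    square-summable; the second term is square-summable by Young's inequality. *)
Lemma nnsummable_weighted_conv :
  nnsummable (fun k => (q k ^+ 2)^-1 * nnsum (fun j => a j * a (k - j)) ^+ 2).
Proof.
pose b k := q k ^+ 3 * a k; pose g k := a k / q k ^+ 4.
have b0 k : 0 <= b k by rewrite mulr_ge0// exprn_ge0// ltW.
have g0 k : 0 <= g k by rewrite mulr_ge0// invr_ge0 exprn_ge0// ltW.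
have b2 : nnsummable (fun k => b k ^+ 2).
  rewrite (_ : (fun k => _) = (fun k => q k ^+ 6 * a k ^+ 2))//.
  by apply/funext => k; rewrite /b; ring.
have gs : nnsummable g.
  apply: nnsummable_le (nnsummableD _ _ qs b2) => k; rewrite g0/=.
  have -> : g k = (q k ^+ 7)^-1 * b k by rewrite /g /b; field; rewrite gt_eqF.
  have -> : (q k ^+ 14)^-1 = ((q k ^+ 7)^-1) ^+ 2 by field; rewrite gt_eqF.
  have : 0 <= (q k ^+ 7)^-1 by rewrite invr_ge0 exprn_ge0// ltW.
  by have := b0 k; move: (b k) (_^-1) => x y; nra.
set M := nnsum (fun k => b k ^+ 2).
have M0 : 0 <= M by apply: nnsum_ge0 => k; exact: sqr_ge0.
pose H k := nnsum (fun j => g j * b (k - j)).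
have H2 : nnsummable (fun k => H k ^+ 2) by exact: nnsummable_young.
have bk k : bijective (fun j : T => k - j).
  by exists (fun j => k - j) => j; rewrite subKr.
have g2 : nnsummable (fun k => g k ^+ 2).
  apply: nnsummable_le nnsummable_sqr_of_weighted => k.
  rewrite sqr_ge0/= lerXn2r ?nnegrE// ler_pdivrMr ?exprn_gt0//.
  by rewrite ler_peMr// exprn_ege1.
have s1 k : nnsummable (fun j => b j * b (k - j)) by exact: nnsummable_convM.
have s2 k : nnsummable (fun j => g j * b (k - j)) by exact: nnsummable_convM.
have s3 k : nnsummable (fun j => b j * g (k - j)) by exact: nnsummable_convM.
have S1 k : nnsum (fun j => b j * b (k - j)) <= M.
  have b2' := nnsummable_reindex (fun j => k - j) (fun i => b i ^+ 2) (bk k) b2.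
  have -> : M = 2^-1 * nnsum (fun j => b j ^+ 2 + b (k - j) ^+ 2).
    rewrite nnsumD// (nnsum_reindex (fun j => k - j) (fun i => b i ^+ 2))// -/M.
    by field.
  rewrite -nnsumZ ?invr_ge0//; last exact: nnsummableD.
  apply: nnsum_le => [j|]; last by apply: nnsummableZ; [lra|exact: nnsummableD].
  rewrite mulr_ge0//=.
  have := sqr_ge0 (b j - b (k - j)); lra.
(* The substitution of k - j for j exchanges the low-high and high-low terms. *)
have S3 k : nnsum (fun j => b j * g (k - j)) = H k.
  rewrite -(nnsum_reindex (fun j => k - j))//; congr nnsum; apply/funext => j.
  by rewrite subKr mulrC.
have key k : (q k)^-1 * nnsum (fun j => a j * a (k - j)) <=
             64 * ((q k ^+ 7)^-1 * M + 2 * H k).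
  rewrite ler_pdivrMl// mulrA [q k * 64]mulrC.
  apply: (@le_trans _ _ (64 * q k * ((q k ^+ 7)^-1 * nnsum (fun j => b j * b (k - j))
      + H k + H k))); last first.
    rewrite ler_pM2l ?mulr_gt0// -addrA mulr2n mulrDl !mul1r lerD2r.
    by rewrite ler_pM2l// invr_gt0 exprn_gt0.
  have q70 : 0 <= (q k ^+ 7)^-1 by rewrite invr_ge0 exprn_ge0// ltW.
  have z1 := nnsummableZ _ _ q70 (s1 k).
  have z2 := nnsummableD _ _ z1 (s2 k); have z3 := nnsummableD _ _ z2 (s3 k).
  have q64 : 0 <= 64 * q k by rewrite mulr_ge0// ltW.
  rewrite -{2}S3 -nnsumZ// -nnsumD// -nnsumD// -nnsumZ//.
  apply: nnsum_le => [j|]; last exact: nnsummableZ.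
  rewrite mulr_ge0//=.
  have := weight_split (q j) (q (k - j)) (q k) (q1 _) (q1 _) (q1 _) (qD j k).
  move/(ler_wpM2l (mulr_ge0 (a0 j) (a0 (k - j)))); rewrite mulr1.
  move=> /le_trans; apply; rewrite le_eqVlt; apply/orP; left; apply/eqP.
  by rewrite /b /g; field; rewrite !gt_eqF.
apply: (nnsummable_le _ (fun k => (64 ^+ 2 * 2) *
          (M ^+ 2 * (q k ^+ 14)^-1 + 4 * H k ^+ 2))); last first.
  apply: nnsummableZ; first by [].
  by apply: nnsummableD; apply: nnsummableZ; rewrite ?sqr_ge0.
move=> k; rewrite -exprVn -exprMn sqr_ge0/=.
have H0 : 0 <= H k by exact: nnsum_ge0 (s2 k).1.
have q70 : 0 <= (q k ^+ 7)^-1 by rewrite invr_ge0 exprn_ge0// ltW.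
apply: (@le_trans _ _ ((64 * ((q k ^+ 7)^-1 * M + 2 * H k)) ^+ 2)).
  rewrite lerXn2r ?nnegrE//.
  - rewrite mulr_ge0 ?invr_ge0 ?(ltW (q0 k))// nnsum_ge0// => j.
    by rewrite mulr_ge0.
  - by rewrite mulr_ge0// addr_ge0// mulr_ge0.
have -> : (q k ^+ 14)^-1 = ((q k ^+ 7)^-1) ^+ 2 by field; rewrite gt_eqF.
have := sqr_ge0 ((q k ^+ 7)^-1 * M - 2 * H k); move: (_^-1) => x; lra.
Qed.

End WeightedConvolution.

(** * Sums over the integers and over lattices *)

Section LatticeSums.
Context {R : realType}.

Lemma ler_sum_nnsum {T : choiceType} (f : T -> R) (s : seq T) :
  nnsummable f -> uniq s -> \sum_(x <- s) f x <= nnsum f.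
Proof.
move=> fs us; rewrite -lee_fin -nnsumE// fsbig_seq// -fsumEFin//.
apply: ereal_sup_ubound; exists [set` s] => //; split => //.
Qed.

Lemma nnsummable_bounded {T : choiceType} (f : T -> R) (M : R) :
  (forall x, 0 <= f x) ->
  (forall s : seq T, uniq s -> \sum_(x <- s) f x <= M) -> nnsummable f.
Proof.
move=> f0 fM; split=> //; apply: le_lt_trans (ltry M).
apply: ge_ereal_sup => _ [X [finX _]] <-.
by rewrite fsbig_finite// sumEFin lee_fin fM// finmap.fset_uniq.
Qed.

Lemma ler_sum_subset {T : eqType} (f : T -> R) (s1 s2 : seq T) :
  (forall x, 0 <= f x) -> uniq s1 -> uniq s2 -> {subset s1 <= s2} ->
  \sum_(x <- s1) f x <= \sum_(x <- s2) f x.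
Proof.
move=> f0 u1 u2 s12.
have -> : \sum_(x <- s1) f x = \sum_(x <- s2 | x \in s1) f x.
  rewrite -[RHS]big_filter; apply: perm_big; apply: uniq_perm => //.
    exact: filter_uniq.
  by move=> x; rewrite mem_filter; case: (boolP (x \in s1)) => //= /s12 ->.
by rewrite big_mkcond; apply: ler_sum => x _; case: ifP.
Qed.

(** A finite set of multi-indices lies in a box s^d, where s lists all coordinates that occur; on
    the box the sum of products factors into the d-th power of a one-dimensional sum. *)
Lemma nnsummable_prod {I : choiceType} (x0 : I) (d : nat) (f : I -> R) :
  nnsummable f -> nnsummable (fun k : {ffun 'I_d -> I} => \prod_c f (k c)).
Proof.
move=> fs; have f0 := fs.1.
apply: (nnsummable_bounded _ (nnsum f ^+ d)) => [k|X uX].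
  exact: prodr_ge0.
pose s := undup [seq (k : {ffun 'I_d -> I}) c | k <- X, c <- enum 'I_d].
have us : uniq s by exact: undup_uniq.
pose h (g : {ffun 'I_d -> 'I_(size s)}) : {ffun 'I_d -> I} :=
  [ffun c => nth x0 s (g c)].
have hinj : injective h.
  move=> g1 g2 /ffunP g12; apply/ffunP => c; apply/val_inj/eqP.
  by move: (g12 c); rewrite !ffunE => /eqP; rewrite nth_uniq.
apply: (@le_trans _ _ (\sum_(k <- map h (enum {ffun 'I_d -> 'I_(size s)}))
    \prod_c f (k c))).
  apply: ler_sum_subset => //; first by move=> k; exact: prodr_ge0.
    by rewrite map_inj_uniq ?enum_uniq.
  move=> k kX.
  have ks c : k c \in s.
    by rewrite mem_undup; apply: allpairs_f; rewrite ?mem_enum.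
  have ki c : (index (k c) s < size s)%N by rewrite index_mem.
  apply/mapP; exists [ffun c => Ordinal (ki c)]; first by rewrite mem_enum.
  by apply/ffunP => c; rewrite !ffunE nth_index.
rewrite big_map big_enum/=.
under eq_bigr do under eq_bigr do rewrite ffunE.
rewrite -(bigA_distr_bigA (fun (c : 'I_d) (i : 'I_(size s)) => f (nth x0 s i))).
rewrite prodr_const card_ord lerXn2r ?nnegrE ?sumr_ge0//; first exact: nnsum_ge0.
by have := ler_sum_nnsum f s fs us; rewrite (big_nth x0) big_mkord.
Qed.

(** [root6 n ^+ 7] is (n + 1)^(7/6). The weight to be summed over the lattice is of order |k|^(7/2);
    shared among three coordinates it leaves the exponent 7/6, still above 1. *)
Definition root6 (n : nat) : R := n.+1%:R `^ (6^-1).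

Lemma root6_gt0 n : 0 < root6 n.
Proof. by rewrite powR_gt0. Qed.

Lemma root6X n : root6 n ^+ 6 = n.+1%:R.
Proof. by rewrite -powR_mulrn ?powR_ge0// -powRrM mulVf// powRr1. Qed.

(** Discrete form of the fact that x^(-7/6) has primitive -6 x^(-1/6). It follows from factoring y^6
    - x^6 = 1, where x <= y are consecutive sixth roots. *)
Lemma root6_step n :
  (root6 n.+1 ^+ 7)^-1 <= 6 * ((root6 n)^-1 - (root6 n.+1)^-1).
Proof.
have := root6X n; have := root6X n.+1; have := root6_gt0 n.
have := root6_gt0 n.+1; rewrite -[n.+2%:R]natr1.
move: (root6 n) (root6 n.+1) (n.+1%:R : R) => x y N y0 x0 yN xN.
have xy : x <= y.
  by rewrite -(@ler_pXn2r R 6 isT) ?nnegrE ?(ltW x0) ?(ltW y0)// xN yN lerDl.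
have y50 : 0 < y ^+ 5 by rewrite exprn_gt0.
have le j : (j <= 5)%N -> x ^+ j * y ^+ (5 - j) <= y ^+ 5.
  move=> j5; rewrite -[in leRHS](subnKC j5) exprD ler_wpM2r ?exprn_ge0 ?(ltW y0)//.
  by rewrite lerXn2r ?nnegrE ?(ltW x0) ?(ltW y0).
have key : 1 <= 6 * (y - x) * y ^+ 5.
  rewrite [leLHS](_ : 1 = (y - x) * (x ^+ 0 * y ^+ (5 - 0) + x ^+ 1 * y ^+ (5 - 1) +
     x ^+ 2 * y ^+ (5 - 2) + x ^+ 3 * y ^+ (5 - 3) + x ^+ 4 * y ^+ (5 - 4) +
     x ^+ 5 * y ^+ (5 - 5))); last first.
    rewrite (_ : 1 = y ^+ 6 - x ^+ 6); last by rewrite yN xN; ring.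
    by rewrite /subn/=; ring.
  rewrite [6 * _]mulrC -[leRHS]mulrA ler_wpM2l ?subr_ge0//.
  have := le 0%N isT; have := le 1%N isT; have := le 2%N isT.
  have := le 3%N isT; have := le 4%N isT; have := le 5%N isT.
  lra.
rewrite (_ : 6 * _ = 6 * (y - x) / (x * y)); last by field; rewrite !gt_eqF.
rewrite ler_pdivlMr ?mulr_gt0// mulrC ler_pdivrMr ?exprn_gt0//.
apply: (@le_trans _ _ (y ^+ 2 * (6 * (y - x) * y ^+ 5))); last first.
  by rewrite (_ : y ^+ 2 * _ = 6 * (y - x) * y ^+ 7)//; ring.
apply: (@le_trans _ _ (y ^+ 2 * 1)); first by rewrite mulr1 expr2 ler_pM2r.
by rewrite ler_wpM2l ?sqr_ge0.
Qed.

Lemma sum_root6_le N : \sum_(n < N) (root6 n ^+ 7)^-1 <= 7.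
Proof.
case: N => [|N]; first by rewrite big_ord0.
(* The telescoped bound is the induction hypothesis; its constant is fixed by the first term, 1 = 7
   - 6. *)
suff : \sum_(n < N.+1) (root6 n ^+ 7)^-1 <= 7 - 6 / root6 N.
  move/le_trans; apply; rewrite gerBl mulr_ge0// invr_ge0 ltW//.
  exact: root6_gt0.
elim: N => [|N IH].
  have -> : root6 0 = 1 by rewrite /root6 powR1.
  by rewrite big_ord1 /root6 powR1 expr1n; lra.
rewrite big_ord_recr/=; have := root6_step N; lra.
Qed.

Lemma nnsummable_int : nnsummable (fun m : int => (root6 `|m| ^+ 7)^-1).
Proof.
apply: (nnsummable_bounded _ (7 + 7)) => [m|s us].
  by rewrite invr_ge0 exprn_ge0// powR_ge0.
have [N Ns] : exists N, forall m, m \in s -> (`|m| < N)%N.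
  by exists (\max_(m <- s) `|m|%N).+1 => m ms; rewrite ltnS leq_bigmax_seq.
pose s' := [seq Posz n | n <- iota 0 N] ++ [seq - Posz n.+1 | n <- iota 0 N].
apply: (@le_trans _ _ (\sum_(m <- s') (root6 `|m| ^+ 7)^-1)).
  apply: ler_sum_subset => //.
  - by move=> m; rewrite invr_ge0 exprn_ge0// powR_ge0.
  - rewrite cat_uniq; apply/and3P; split.
    + by rewrite map_inj_uniq ?iota_uniq// => m n [].
    + by apply/hasPn => _ /mapP[n _ ->]; apply/mapP => -[m _].
    + by rewrite map_inj_uniq ?iota_uniq// => m n /oppr_inj [].
  - move=> m ms; have mN := Ns m ms.
    rewrite mem_cat; case: m ms mN => n ms nN.
      by rewrite map_f// mem_iota.
    apply/orP; right; apply/mapP; exists n; rewrite ?mem_iota//.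
    by rewrite (leq_trans _ nN).
rewrite big_cat !big_map/=; apply: lerD.
  by rewrite -[N]subn0 -/(index_iota 0 N) big_mkord sum_root6_le.
rewrite -[N]subn0 -/(index_iota 0 N) big_mkord.
(* The negative integers contribute the indices 1 to N, so the bound for [N.+1] terms is used and
   its term of index 0 is dropped. *)
apply: le_trans (sum_root6_le N.+1); rewrite big_ord_recl/=.
by rewrite ler_wpDl ?invr_ge0 ?exprn_ge0 ?powR_ge0.
Qed.

End LatticeSums.

(** * Fourier weights *)

Section Weights.
Context {R : realType} {d : nat} (L : 'I_d -> R).
Hypothesis L_gt0 : forall c, 0 < L c.
Implicit Types j k : mode d.

Lemma powR_ge1 (x a : R) : 1 <= x -> 0 <= a -> 1 <= x `^ a.
Proof. by move=> x1 a0; rewrite -(powRr0 x) ler_powR. Qed.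

Lemma mode_subE k j : mode_sub k j = k - j.
Proof. by apply/ffunP => c; rewrite !ffunE. Qed.

Lemma lam_ge0 k : 0 <= lam L k.
Proof. by apply: sumr_ge0 => c _; exact: sqr_ge0. Qed.

Lemma wv_sqr_le k c : wv L k c ^+ 2 <= lam L k.
Proof.
rewrite /lam (bigD1 c)//= lerDl; apply: sumr_ge0 => e _; exact: sqr_ge0.
Qed.

Lemma lam0 : lam L (mode0 d) = 0.
Proof.
apply: big1 => c _.
by rewrite /wv ffunE mulr0 mul0r expr0n.
Qed.

Lemma lamD j k : lam L k <= 2 * lam L j + 2 * lam L (k - j).
Proof.
rewrite /lam !mulr_sumr -big_split; apply: ler_sum => c _ /=.
have -> : wv L k c = wv L j c + wv L (k - j) c.
  by rewrite /wv !ffunE -mulrDl -mulrDr -intrD addrC subrK.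
have := sqr_ge0 (wv L j c - wv L (k - j) c); lra.
Qed.

(** A single component of the wave vector bounds [lam] from below; replacing each side length by the
    common bound [S] makes the constant the same for all coordinates. *)
Lemma lam_lower : exists2 w, 0 < w &
  forall k c, w * (`|k c|%:R) ^+ 2 <= lam L k.
Proof.
pose S := 1 + \sum_c L c.
have S0 : 0 < S by rewrite ltr_pwDl// sumr_ge0// => c _; exact: ltW.
have LS c : L c <= S.
  by rewrite /S (bigD1 c)//= addrCA lerDl addr_ge0// sumr_ge0// => e _; exact: ltW.
exists ((2 * pi / S) ^+ 2) => [|k c].
  by rewrite exprn_gt0// divr_gt0// mulr_gt0// pi_gt0.
apply: le_trans (wv_sqr_le k c).
rewrite /wv -!exprMn.
rewrite -[leRHS]real_normK ?num_real// lerXn2r ?nnegrE//.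
- by rewrite mulr_ge0// divr_ge0// ?ltW// mulr_gt0// pi_gt0.
- rewrite !normrM (ger0_norm (pi_ge0 R)) normfV (gtr0_norm (L_gt0 c)) normr_nat.
  rewrite mulrAC ler_pM//.
  + by rewrite !mulr_ge0// pi_ge0.
  + by rewrite invr_ge0 ltW.
  + by rewrite -intr_norm natr_absz.
  + by rewrite lef_pV2// posrE.
Qed.

Lemma lam_gt_lower : exists2 w, 0 < w & forall k, k != mode0 d -> w <= lam L k.
Proof.
have [w w0 hw] := lam_lower; exists w => // k k0.
have [c kc] : exists c, k c != 0.
  apply/existsP; rewrite -negb_forall; apply: contra k0 => /forallP h.
  by apply/eqP/ffunP => c; rewrite ffunE; exact/eqP.
apply: le_trans (hw k c); rewrite ler_peMr ?(ltW w0)// exprn_ege1//.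
by rewrite ler1n lt0n absz_eq0.
Qed.

Lemma lambda1_le k : k != mode0 d -> lambda1 L <= lam L k.
Proof.
move=> k0; apply: ge_inf; last by exists k.
by exists 0 => _ [j _ <-]; exact: lam_ge0.
Qed.

Lemma lambda1_gt0 : (0 < d)%N -> 0 < lambda1 L.
Proof.
move=> d0; have [w w0 hw] := lam_gt_lower.
apply: lt_le_trans w0 _; apply: lb_le_inf.
  exists (lam L [ffun => 1%Z]); exists [ffun => 1%Z] => //=.
  by apply/eqP => /ffunP /(_ (Ordinal d0)); rewrite !ffunE.
by move=> _ [k k0 <-]; exact: hw.
Qed.

(** The exponent 1/8 turns the Sobolev weights in use into integer powers: [wt k ^+ 6] for H^{3/4}
    and [wt k ^+ 8] for a gain of two derivatives. *)
Definition wt k : R := (1 + lam L k) `^ (8^-1).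

Lemma wt_ge1 k : 1 <= wt k.
Proof.
by apply: powR_ge1; rewrite ?invr_ge0// lerDl lam_ge0.
Qed.

Lemma wtX8 k : wt k ^+ 8 = 1 + lam L k.
Proof.
by rewrite -powR_mulrn ?powR_ge0// -powRrM mulVf// powRr1// addr_ge0// lam_ge0.
Qed.

(** After raising to the eighth power, [lamD] suffices: lam k is at most 4 times the larger of the
    two values, well below 2^8 = 256 times. *)
Lemma wt_sub j k : (wt k <= 2 * wt j) || (wt k <= 2 * wt (k - j)).
Proof.
have e j' : (wt k <= 2 * wt j') = (1 + lam L k <= 256 * (1 + lam L j')).
  have w0 i : 0 <= wt i by exact: le_trans (wt_ge1 i).
  rewrite -(@ler_pXn2r R 8 isT) ?nnegrE ?mulr_ge0// wtX8 exprMn wtX8.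
  by congr (_ <= _ * _); ring.
rewrite !e; have := lamD j k; have := lam_ge0 j; have := lam_ge0 (k - j).
move=> a b c; apply/orP.
have [h|h] := leP (lam L j) (lam L (k - j)); [right|left]; lra.
Qed.

(** Each coordinate satisfies c1 (|k_c| + 1)^(1/6) <= h^2, where h^3 is the weight. Multiplying the
    seventh powers over the d coordinates bounds the product by h^(14 d), which is at most h^42 =
    [wt k ^+ 14] exactly when d <= 3 is available. *)
Lemma nnsummable_wt : (d <= 3)%N -> nnsummable (fun k => (wt k ^+ 14)^-1).
Proof.
move=> d3; have [w w0 hw] := lam_lower.
(* Chosen so that c0 (x + 1)^2 <= 1 + w x^2, by (x + 1)^2 <= 2 (1 + x^2). *)
pose c0 := Num.min 1 w / 2.
have m0 : 0 < Num.min 1 w by rewrite lt_min ltr01.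
have c00 : 0 < c0 by rewrite divr_gt0.
pose c1 := c0 `^ (12^-1); have c10 : 0 < c1 by rewrite powR_gt0.
have c1X : c1 ^+ 12 = c0.
  by rewrite -powR_mulrn ?(ltW c10)// -powRrM mulVf// powRr1// ltW.
pose h k : R := (1 + lam L k) `^ (24^-1).
have h1 k : 1 <= h k.
  by apply: powR_ge1; rewrite ?invr_ge0// lerDl lam_ge0.
have h0 k : 0 <= h k by exact: le_trans (h1 k).
have hX24 k : h k ^+ 24 = 1 + lam L k.
  by rewrite -powR_mulrn// -powRrM mulVf// powRr1// addr_ge0// lam_ge0.
have hX3 k : wt k = h k ^+ 3.
  rewrite -powR_mulrn// -powRrM; congr (_ `^ _); by field.
have hc k c : c1 * root6 `|k c| <= h k ^+ 2.
  have r0 : 0 <= root6 `|k c| :> R by rewrite ltW// root6_gt0.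
  rewrite -(@ler_pXn2r R 12 isT) ?nnegrE ?exprn_ge0 ?mulr_ge0 ?(ltW c10)//.
  rewrite exprMn c1X -exprM hX24 -[12%N]/(6 * 2)%N exprM root6X -natr1.
  have := hw k c; move: (`|k c|%:R) => x hx.
  have : Num.min 1 w <= 1 by rewrite ge_min lexx.
  have : Num.min 1 w <= w by rewrite ge_min lexx orbT.
  rewrite /c0; move: (Num.min 1 w) m0 => m mp mw m1.
  have : m * x ^+ 2 <= w * x ^+ 2 by rewrite ler_wpM2r// sqr_ge0.
  have : 0 <= m * (x - 1) ^+ 2 by rewrite mulr_ge0 ?sqr_ge0// ltW.
  nra.
have fs : nnsummable (fun m : int => (c1 ^+ 7)^-1 * (root6 `|m| ^+ 7 : R)^-1).
  apply: nnsummableZ; last exact: nnsummable_int.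
  by rewrite invr_ge0 exprn_ge0// ltW.
apply: nnsummable_le (nnsummable_prod (0 : int) d _ fs) => k.
rewrite invr_ge0 hX3 !exprn_ge0//=.
under eq_bigr do rewrite -invfM -exprMn.
rewrite prodfV lef_pV2 ?posrE; last 2 first.
- by rewrite !exprn_gt0// (lt_le_trans ltr01).
- by apply: prodr_gt0 => c _; rewrite exprn_gt0// mulr_gt0// root6_gt0.
apply: (@le_trans _ _ (\prod_(c < d) (h k ^+ 2) ^+ 7)).
  apply: ler_prod => c _; rewrite exprn_ge0/= ?mulr_ge0 ?(ltW c10) ?powR_ge0//.
  by rewrite lerXn2r ?nnegrE ?exprn_ge0 ?mulr_ge0 ?(ltW c10) ?powR_ge0.
rewrite prodr_const card_ord -!exprM; apply: ler_weXn2l => //.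
by rewrite mulnA mulnC; exact: (leq_mul d3).
Qed.

End Weights.

(** * Complex moduli and signed sums *)

Section ComplexSums.
Context {R : realType}.
Local Notation normc := (@ComplexField.Normc.normc R).

Lemma sqabsE (z : R[i]) : sqabs z = normc z ^+ 2.
Proof. by case: z => a b; rewrite sqr_sqrtr// addr_ge0// sqr_ge0. Qed.

Lemma normc_ge0 (z : R[i]) : 0 <= normc z.
Proof. by case: z => a b; exact: sqrtr_ge0. Qed.

Lemma sqabs_ge0 (z : R[i]) : 0 <= sqabs z.
Proof. by rewrite sqabsE sqr_ge0. Qed.

Lemma sqabsM (x y : R[i]) : sqabs (x * y) = sqabs x * sqabs y.
Proof. by case: x y => [a b] [c e]; rewrite /sqabs/=; ring. Qed.

Lemma sqabsC (a : R) : sqabs a%:C = a ^+ 2.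
Proof. by rewrite /sqabs/= expr0n addr0. Qed.

Lemma sqabsN (x : R[i]) : sqabs (- x) = sqabs x.
Proof. by case: x => [a b]; rewrite /sqabs/= !sqrrN. Qed.

Lemma sqabsD (x y : R[i]) : sqabs (x + y) <= 2 * sqabs x + 2 * sqabs y.
Proof.
case: x y => [a b] [c e]; rewrite /sqabs/=.
have := sqr_ge0 (a - c); have := sqr_ge0 (b - e); lra.
Qed.

Lemma normcC (a : R) : normc a%:C = `|a|.
Proof. by rewrite /= expr0n addr0 sqrtr_sqr. Qed.

Lemma normRe_le (z : R[i]) : `|complex.Re z| <= normc z.
Proof. by case: z => a b /=; rewrite -sqrtr_sqr ler_wsqrtr// lerDl sqr_ge0. Qed.

Lemma normIm_le (z : R[i]) : `|complex.Im z| <= normc z.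
Proof. by case: z => a b /=; rewrite -sqrtr_sqr ler_wsqrtr// lerDr sqr_ge0. Qed.

Lemma normc_le (a b : R) : normc (a +i* b) <= `|a| + `|b|.
Proof.
rewrite -[leRHS]ger0_norm ?addr_ge0// -sqrtr_sqr ler_wsqrtr//.
rewrite -(real_normK (num_real a)) -(real_normK (num_real b)).
have : 0 <= `|a| * `|b| by rewrite mulr_ge0.
lra.
Qed.

Lemma normc_sum (I : finType) (f : I -> R[i]) :
  normc (\sum_i f i) <= \sum_i normc (f i).
Proof.
apply: (big_ind2 (fun x y => normc x <= y)) => //.
  by rewrite ComplexField.Normc.normc0.
by move=> x a y b xa yb; apply: le_trans (le_normcD x y) _; exact: lerD.
Qed.

Lemma sum_le_const (n : nat) (f : 'I_n -> R) (C : R) :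
  (forall i, f i <= C) -> \sum_i f i <= n%:R * C.
Proof.
move=> fC; apply: (@le_trans _ _ (\sum_(i < n) C)); first exact: ler_sum.
by rewrite sumr_const card_ord mulr_natl.
Qed.

Lemma nnsummable_pos {T : choiceType} (f g : T -> R) :
  (forall x, `|f x| <= g x) -> nnsummable g ->
  nnsummable (fun x => Num.max (f x) 0) /\
  nnsummable (fun x => Num.max (- f x) 0).
Proof.
move=> fg gs; have {}fg x : - g x <= f x <= g x by rewrite -ler_norml.
have g0 := gs.1; split; apply: nnsummable_le gs => x;
  rewrite le_max lexx orbT/= ge_max g0 andbT; case/andP: (fg x) => //.
by rewrite lerNl.
Qed.

Lemma ssumE {T : choiceType} (f : T -> R) :
  ssum f = nnsum (fun x => Num.max (f x) 0) - nnsum (fun x => Num.max (- f x) 0).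
Proof. by []. Qed.

Lemma ssum_le {T : choiceType} (f g : T -> R) :
  (forall x, `|f x| <= g x) -> nnsummable g -> `|ssum f| <= nnsum g.
Proof.
move=> fg gs; have {}fg x : - g x <= f x <= g x by rewrite -ler_norml.
have g0 := gs.1; rewrite ssumE.
have : nnsum (fun x => Num.max (f x) 0) <= nnsum g.
  apply: nnsum_le => // x; rewrite le_max lexx orbT ge_max g0 andbT/=.
  by case/andP: (fg x).
have : nnsum (fun x => Num.max (- f x) 0) <= nnsum g.
  apply: nnsum_le => // x; rewrite le_max lexx orbT ge_max g0 andbT/=.
  by rewrite lerNl; case/andP: (fg x).
have : 0 <= nnsum (fun x => Num.max (f x) 0).
  by apply: nnsum_ge0 => x; rewrite le_max lexx orbT.
have : 0 <= nnsum (fun x => Num.max (- f x) 0).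
  by apply: nnsum_ge0 => x; rewrite le_max lexx orbT.
move=> *; rewrite ler_norml; lra.
Qed.

(** The factor 2 pays for bounding the real and imaginary sums separately. *)
Lemma csum_le {T : choiceType} (f : T -> R[i]) (g : T -> R) :
  (forall x, normc (f x) <= g x) -> nnsummable g ->
  normc (csum f) <= 2 * nnsum g.
Proof.
move=> fg gs; apply: le_trans (normc_le _ _) _.
rewrite mulr_natl mulr2n lerD// ssum_le// => x.
  exact: le_trans (normRe_le _) (fg x).
exact: le_trans (normIm_le _) (fg x).
Qed.

End ComplexSums.

(** * The scalar functions phi_0 and phi_1 *)

Section Phi.
Context {R : realType}.

Lemma phi1E (z : R) : z * phi1 z = 1 - phi0 z.
Proof.
rewrite /phi1 /phi0; case: eqVneq => [->|z0]; first by rewrite mul0r oppr0 expR0 subrr.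
by rewrite mulrC mulfVK.
Qed.

Lemma phi0_gt0 (z : R) : 0 < phi0 z.
Proof. exact: expR_gt0. Qed.

Lemma phi0_le1 (z : R) : 0 <= z -> phi0 z <= 1.
Proof. by move=> z0; rewrite /phi0 -expR0 ler_expR oppr_le0. Qed.

Lemma phi1_ge0 (z : R) : 0 <= z -> 0 <= phi1 z.
Proof.
rewrite le_eqVlt => /predU1P[<-|z0]; first by rewrite /phi1 eqxx.
by rewrite -(pmulr_rge0 _ z0) phi1E subr_ge0 phi0_le1// ltW.
Qed.

Lemma phi1_le1 (z : R) : 0 <= z -> phi1 z <= 1.
Proof.
rewrite le_eqVlt => /predU1P[<-|z0]; first by rewrite /phi1 eqxx.
rewrite -(ler_pM2l z0) phi1E mulr1 lerBlDl.
by have := expR_ge1Dx (- z); rewrite /phi0; lra.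
Qed.

Lemma mul_phi1_le1 (z : R) : z * phi1 z <= 1.
Proof. by rewrite phi1E gerBl ltW// phi0_gt0. Qed.

End Phi.

(** * Propagation of regularity *)

Section Regularity.
Context {R : realType} {d : nat} (L : 'I_d -> R).
Hypothesis L_gt0 : forall c, 0 < L c.
Local Notation normc := (@ComplexField.Normc.normc R).
Implicit Types u v : @vfield R d.

Definition energy u k : R := \sum_c sqabs (u k c).

Lemma energy_ge0 u k : 0 <= energy u k.
Proof. by apply: sumr_ge0 => c _; exact: sqabs_ge0. Qed.

Lemma normc_le_energy u k c : normc (u k c) <= Num.sqrt (energy u k).
Proof.
rewrite -[normc _]ger0_norm ?normc_ge0// -sqrtr_sqr -sqabsE ler_wsqrtr//.
rewrite /energy (bigD1 c)//= lerDl sumr_ge0// => e _; exact: sqabs_ge0.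
Qed.

Lemma normwv_le k c : `|wv L k c| <= Num.sqrt (lam L k).
Proof. by rewrite -sqrtr_sqr ler_wsqrtr// wv_sqr_le. Qed.

Lemma energy_comb (w1 w2 w3 : @vfield R d) u k (a b e : R) :
  (forall c, u k c = a%:C * w1 k c - b%:C * w2 k c + e%:C * w3 k c) ->
  energy u k <= 4 * a ^+ 2 * energy w1 k + 4 * b ^+ 2 * energy w2 k
               + 2 * e ^+ 2 * energy w3 k.
Proof.
move=> ue; rewrite /energy !mulr_sumr -!big_split; apply: ler_sum => c _ /=.
rewrite ue; apply: le_trans (sqabsD _ _) _.
have := sqabsD (a%:C * w1 k c) (- (b%:C * w2 k c)).
rewrite sqabsN !sqabsM !sqabsC; lra.
Qed.

Definition regular u : Prop := nnsummable (fun k => wt L k ^+ 6 * energy u k).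

Lemma wt_gt0 k : 0 < wt L k.
Proof. exact: lt_le_trans ltr01 (wt_ge1 L k). Qed.

Lemma regular_energy u : regular u -> nnsummable (energy u).
Proof.
apply: nnsummable_le => k; rewrite energy_ge0/=.
by rewrite ler_peMl ?energy_ge0// exprn_ege1// wt_ge1.
Qed.

Lemma regular_comb u w1 w2 (a b : R) : regular w1 -> regular w2 ->
  (forall k c, u k c = a%:C * w1 k c - b%:C * w2 k c) -> regular u.
Proof.
move=> r1 r2 ue.
have a0 : 0 <= 4 * a ^+ 2 by rewrite mulr_ge0// sqr_ge0.
have b0 : 0 <= 4 * b ^+ 2 by rewrite mulr_ge0// sqr_ge0.
apply: nnsummable_le (nnsummableD _ _ (nnsummableZ _ _ a0 r1)
  (nnsummableZ _ _ b0 r2)) => k.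
have w0 : 0 <= wt L k ^+ 6 by rewrite exprn_ge0// ltW// wt_gt0.
rewrite mulr_ge0 ?energy_ge0//=.
have uk c : u k c = a%:C * w1 k c - b%:C * w2 k c + (0 : R)%:C * w1 k c.
  by rewrite ue mul0r addr0.
have := ler_wpM2l w0 (energy_comb _ _ _ _ _ _ _ _ uk); lra.
Qed.

(** Up to constants, this majorizes the k-th Fourier coefficient of the tensor product of u with
    itself. *)
Definition selfconv u k : R :=
  nnsum (fun j => Num.sqrt (energy u j) * Num.sqrt (energy u (k - j))).

(** In the gradient part, the two wave-vector factors are each at most sqrt(lam k) and cancel the
    division by [lam L k]; the sum over components costs the factor d. *)
Lemma leray_le k (v : 'I_d -> R[i]) (V : R) c :
  (forall c, normc (v c) <= V) -> normc (leray_mode L k v c) <= (1 + d%:R) * V.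
Proof.
move=> hv; have V0 : 0 <= V by exact: le_trans (normc_ge0 _) (hv c).
rewrite /leray_mode; case: eqVneq => [_|l0].
  by rewrite ComplexField.Normc.normc0 mulr_ge0// addr_ge0.
have lp : 0 < lam L k by rewrite lt0r l0 lam_ge0.
apply: le_trans (le_normcD _ _) _; rewrite normcN mulrDl mul1r lerD//.
rewrite !ComplexField.Normc.normcM ComplexField.Normc.normcV !normcC (gtr0_norm lp).
rewrite ler_pdivrMr//.
have -> : d%:R * V * lam L k = Num.sqrt (lam L k) * (d%:R * (Num.sqrt (lam L k) * V)).
  by rewrite -{1}(sqr_sqrtr (ltW lp)); ring.
apply: ler_pM => //; rewrite ?normc_ge0 ?normwv_le//.
apply: le_trans (normc_sum _ _) _.
apply: sum_le_const => e; rewrite ComplexField.Normc.normcM normcC.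
by apply: ler_pM; rewrite ?normc_ge0 ?normwv_le.
Qed.

Lemma nnsummable_selfconv u k : nnsummable (energy u) ->
  nnsummable (fun j => Num.sqrt (energy u j) * Num.sqrt (energy u (k - j))).
Proof.
move=> us; have e : (fun j => Num.sqrt (energy u j) ^+ 2) = energy u.
  by apply/funext => j; rewrite sqr_sqrtr// energy_ge0.
apply: (nnsummable_convM (fun j => Num.sqrt (energy u j))
  (fun j => Num.sqrt (energy u j))); rewrite ?e// => j; exact: sqrtr_ge0.
Qed.

(** In divergence form the derivative falls on the output mode, so it costs only sqrt(lam k),
    outside the convolution. The constants come from the component sums, from [leray_le] and from
    [csum_le]. *)
Lemma energy_Bop u k : nnsummable (energy u) ->
  energy (Bop L u u) k <=
  d%:R * ((1 + d%:R) * (2 * (d%:R * Num.sqrt (lam L k) * selfconv u k))) ^+ 2.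
Proof.
move=> us; have A0 : 0 <= d%:R * Num.sqrt (lam L k) by rewrite mulr_ge0// sqrtr_ge0.
have S0 : 0 <= selfconv u k.
  by apply: nnsum_ge0 => j; rewrite mulr_ge0 ?sqrtr_ge0.
apply: sum_le_const => c; rewrite sqabsE lerXn2r ?nnegrE ?normc_ge0//.
  by rewrite mulr_ge0 ?addr_ge0// mulr_ge0// mulr_ge0.
apply: leray_le => e.
rewrite ComplexField.Normc.normcM.
have -> : normc 'i = 1 by rewrite /= expr0n expr1n add0r sqrtr1.
rewrite mul1r.
rewrite -nnsumZ//; last exact: nnsummable_selfconv.
apply: csum_le => [j|]; last by apply: nnsummableZ => //; exact: nnsummable_selfconv.
rewrite ComplexField.Normc.normcM mode_subE mulrA.
apply: ler_pM; rewrite ?normc_ge0 ?normc_le_energy//.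
apply: le_trans (normc_sum _ _) _.
rewrite -mulrA; apply: sum_le_const => c'; rewrite ComplexField.Normc.normcM normcC.
by apply: ler_pM; rewrite ?normc_ge0 ?normwv_le ?normc_le_energy.
Qed.

End Regularity.

(** * Smoothing by phi_1 and one step of the velocity scheme *)

Section Step.
Context {R : realType} {d : nat} (L : 'I_d -> R).
Hypothesis L_gt0 : forall c, 0 < L c.
Implicit Types u v w f : @vfield R d.

Lemma energy_specL (h : R -> R) s u k :
  energy (specL L h s u) k = h (s * lam L k) ^+ 2 * energy u k.
Proof.
rewrite /energy mulr_sumr; apply: eq_bigr => c _.
by rewrite /specL sqabsM sqabsC.
Qed.

(** The 1 in 1 + lam uses phi_1 <= 1, and lam uses z phi_1(z) <= 1: two derivatives are gained at
    the price of s^-1. *)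
Lemma phi1_smoothing s k : 0 < s ->
  wt L k ^+ 8 * phi1 (s * lam L k) <= 1 + s^-1.
Proof.
move=> s0; have l0 := lam_ge0 L k; rewrite wtX8 mulrDl mul1r lerD//.
  by rewrite phi1_le1// mulr_ge0// ltW.
by rewrite -(ler_pM2l s0) mulfV ?gt_eqF// mulrA mul_phi1_le1.
Qed.

Lemma regular_phi1 s f : 0 < s -> nnsummable (energy f) ->
  regular L (specL L phi1 s f).
Proof.
move=> s0 fs; have c0 : 0 <= 1 + s^-1 by rewrite addr_ge0// invr_ge0 ltW.
apply: nnsummable_le (nnsummableZ _ _ c0 fs) => k.
have l0 := lam_ge0 L k; have sl0 : 0 <= s * lam L k by rewrite mulr_ge0// ltW.
have w0 := wt_gt0 L k; have e0 := energy_ge0 f k.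
rewrite energy_specL; have p0 := phi1_ge0 _ sl0; have p1 := phi1_le1 _ sl0.
rewrite mulr_ge0 ?exprn_ge0 ?(ltW w0)//; last by rewrite mulr_ge0// sqr_ge0.
rewrite /= mulrA ler_wpM2r//; apply: le_trans (phi1_smoothing _ k s0).
apply: ler_pM; rewrite ?exprn_ge0 ?(ltW w0)//.
  by rewrite ler_weXn2l// wt_ge1.
by rewrite expr2 ler_piMl.
Qed.

Lemma regular_phi0 s u : 0 <= s -> regular L u -> regular L (specL L phi0 s u).
Proof.
move=> s0; apply: nnsummable_le => k.
have l0 := lam_ge0 L k; have sl0 : 0 <= s * lam L k by rewrite mulr_ge0.
have w0 := wt_gt0 L k; have e0 := energy_ge0 u k.
rewrite energy_specL mulr_ge0 ?exprn_ge0 ?(ltW w0)//=; last first.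
  by rewrite mulr_ge0// sqr_ge0.
rewrite ler_wpM2l ?exprn_ge0 ?(ltW w0)// ler_piMl//.
by rewrite exprn_ile1 ?phi0_le1// ltW// phi0_gt0.
Qed.

(** The squared norm contains phi_1 twice. One factor absorbs the [lam L k] produced by the
    derivative in [Bop]; the other absorbs [wt L k ^+ 8], leaving the weight wt^-2 of the
    convolution estimate. *)
Lemma regular_phi1_Bop s u : (d <= 3)%N -> 0 < s -> regular L u ->
  regular L (specL L phi1 s (Bop L u u)).
Proof.
move=> d3 s0 ur; have us := regular_energy L u ur.
have conv : nnsummable (fun k => (wt L k ^+ 2)^-1 * selfconv u k ^+ 2).
  apply: nnsummable_weighted_conv.
  - exact: wt_ge1.
  - exact: wt_sub.
  - by move=> k; exact: sqrtr_ge0.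
  - exact: nnsummable_wt.
  - rewrite (_ : (fun k => _) = (fun k => wt L k ^+ 6 * energy u k))//.
    by apply/funext => k; rewrite sqr_sqrtr// energy_ge0.
pose D : R := d%:R * ((1 + d%:R) * (2 * d%:R)) ^+ 2.
have D0 : 0 <= D by rewrite mulr_ge0// sqr_ge0.
have si0 : 0 <= s^-1 by rewrite invr_ge0 ltW.
have c0 : 0 <= D * (1 + s^-1) * s^-1 by rewrite mulr_ge0// mulr_ge0// addr_ge0.
apply: nnsummable_le (nnsummableZ _ _ c0 conv) => k.
have l0 := lam_ge0 L k; have sl0 : 0 <= s * lam L k by rewrite mulr_ge0// ltW.
have w0 := wt_gt0 L k; have e0 := energy_ge0 (Bop L u u) k.
have p0 := phi1_ge0 _ sl0.
rewrite energy_specL mulr_ge0 ?exprn_ge0 ?(ltW w0)//=; last first.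
  by rewrite mulr_ge0// sqr_ge0.
have lp : lam L k * phi1 (s * lam L k) <= s^-1.
  by rewrite -(ler_pM2l s0) mulfV ?gt_eqF// mulrA mul_phi1_le1.
have S2 : 0 <= (wt L k ^+ 2)^-1 * selfconv u k ^+ 2 by exact: conv.1.
apply: (@le_trans _ _ (D * (wt L k ^+ 8 * phi1 (s * lam L k)) *
   (lam L k * phi1 (s * lam L k)) * ((wt L k ^+ 2)^-1 * selfconv u k ^+ 2))).
  have -> : D * (wt L k ^+ 8 * phi1 (s * lam L k)) *
   (lam L k * phi1 (s * lam L k)) * ((wt L k ^+ 2)^-1 * selfconv u k ^+ 2)
   = wt L k ^+ 6 * (phi1 (s * lam L k) ^+ 2 * (d%:R * ((1 + d%:R) *
     (2 * (d%:R * Num.sqrt (lam L k) * selfconv u k))) ^+ 2)).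
    by rewrite -{2}(sqr_sqrtr l0) /D; field; rewrite gt_eqF.
  rewrite ler_wpM2l ?exprn_ge0 ?(ltW w0)// ler_wpM2l ?sqr_ge0//.
  exact: energy_Bop.
rewrite ler_wpM2r//; apply: ler_pM => //.
- by rewrite mulr_ge0// mulr_ge0// exprn_ge0// ltW.
- by rewrite mulr_ge0.
- by rewrite ler_wpM2l// phi1_smoothing.
Qed.

Lemma regular_step u v f w s (b e : R) : (d <= 3)%N -> 0 < s ->
  regular L u -> regular L v -> nnsummable (energy f) ->
  (forall k c, w k c = specL L phi0 s u k c
     - b%:C * specL L phi1 s (Bop L v v) k c + e%:C * specL L phi1 s f k c) ->
  regular L w.
Proof.
move=> d3 s0 ur vr fs we.
apply: (regular_comb L w
   (fun k c => specL L phi0 s u k c - b%:C * specL L phi1 s (Bop L v v) k c)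
   (specL L phi1 s f) 1 (- e)).
- apply: (regular_comb L _ (specL L phi0 s u) (specL L phi1 s (Bop L v v)) 1 b).
  + exact: regular_phi0 (ltW s0) ur.
  + exact: regular_phi1_Bop.
  + by move=> k c; rewrite mul1r.
- exact: regular_phi1.
- by move=> k c; rewrite we mul1r rmorphN mulNr opprK.
Qed.

(** Monotonicity of phi_1, from the tangent-line bound for exp. It allows every decay rate above
    theta to be replaced by theta. *)
Lemma one_sub_expR_le (x y : R) : 0 < x -> x <= y ->
  (1 - expR (- y)) / y <= (1 - expR (- x)) / x.
Proof.
move=> x0 xy; have y0 : 0 < y by exact: lt_le_trans xy.
rewrite ler_pdivrMr// mulrAC ler_pdivlMr//.
have E0 := expR_gt0 (- x).
have h1 : expR (- x) * (1 + x) <= 1.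
  apply: (@le_trans _ _ (expR (- x) * expR x)).
    by rewrite ler_pM2l// expR_ge1Dx.
  by rewrite -expRD addNr expR0.
have h2 : expR (- x) * (1 + (x - y)) <= expR (- y).
  rewrite [in leRHS](_ : - y = - x + (x - y)); last by ring.
  by rewrite expRD ler_pM2l// expR_ge1Dx.
have yx : 0 <= y - x by rewrite subr_ge0.
have := ler_wpM2l yx h1; have := ler_wpM2l (ltW x0) h2.
nra.
Qed.

End Step.

(** * The energy inequality *)

Section EnergyStep.
Context {R : realType} {d : nat} (L : 'I_d -> R).
Hypothesis L_gt0 : forall c, 0 < L c.
Implicit Types u v w f beta : @vfield R d.

Definition pairing u v (k : mode d) : R :=
  \sum_c complex.Re (u k c * conjc (v k c)).

(** Multiply the equation by twice the conjugate of w. Young's inequality with weights e and 1 - e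
    produces |w|^2 with total coefficient exactly 1, which the left-hand side absorbs. *)
Lemma complex_energy (u beta f w : R[i]) (e b m : R) : 0 <= e <= 1 ->
  w = e%:C * u - b%:C * beta + ((1 - e) * m)%:C * f ->
  sqabs w + 2 * b * complex.Re (beta * conjc w) <=
  e * sqabs u + (1 - e) * m ^+ 2 * sqabs f.
Proof.
move=> /andP[e0 e1]; case: u beta f w => [u1 u2] [b1 b2] [f1 f2] [w1 w2] /eqP.
rewrite eq_complex/= !mul0r !subr0 !addr0 => /andP[/eqP E1 /eqP E2].
rewrite /sqabs/= mulrN opprK.
have h1 : 0 <= e * ((u1 - w1) ^+ 2 + (u2 - w2) ^+ 2).
  by rewrite mulr_ge0// addr_ge0// sqr_ge0.
have h2 : 0 <= (1 - e) * ((m * f1 - w1) ^+ 2 + (m * f2 - w2) ^+ 2).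
  by rewrite mulr_ge0 ?subr_ge0// addr_ge0// sqr_ge0.
have F1 : w1 * (w1 - (e * u1 - b * b1 + (1 - e) * m * f1)) = 0.
  by rewrite -E1 subrr mulr0.
have F2 : w2 * (w2 - (e * u2 - b * b2 + (1 - e) * m * f2)) = 0.
  by rewrite -E2 subrr mulr0.
lra.
Qed.

Lemma normr_pairing_le u v k : `|pairing u v k| <= energy u k + energy v k.
Proof.
rewrite /pairing /energy -big_split/=; apply: le_trans (ler_norm_sum _ _ _) _.
apply: ler_sum => c _; rewrite /sqabs; case: (u k c) (v k c) => [a b] [x y] /=.
rewrite mulrN opprK ler_norml.
have := sqr_ge0 (a - x); have := sqr_ge0 (b - y).
have := sqr_ge0 (a + x); have := sqr_ge0 (b + y).
have := sqr_ge0 a; have := sqr_ge0 b; have := sqr_ge0 x; have := sqr_ge0 y.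
move=> *; apply/andP; split; lra.
Qed.

(* [ssum] is only additive on absolutely summable families; the negative part
   of [g], or its positive part if [b < 0], is moved to the right-hand side. *)
Lemma nnsum_ssum_le {T : choiceType} (f g h G : T -> R) (b : R) :
  nnsummable f -> nnsummable h -> nnsummable G ->
  (forall x, `|g x| <= G x) -> (forall x, f x + b * g x <= h x) ->
  nnsum f + b * ssum g <= nnsum h.
Proof.
move=> fs hs Gs gG fgh; have [gp gn] := nnsummable_pos g G gG Gs.
have gE x : g x = Num.max (g x) 0 - Num.max (- g x) 0.
  by case: (leP (g x) 0) => gx; case: (leP (- g x) 0) => ngx; lra.
rewrite ssumE; have [b0|b0] := leP 0 b.
  rewrite mulrBr addrA lerBlDr -!nnsumZ// -!nnsumD//; try exact: nnsummableZ.
  apply: nnsum_le; last by apply: nnsummableD => //; exact: nnsummableZ.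
  move=> x; apply/andP; split.
    by rewrite addr_ge0 ?fs.1// mulr_ge0// gp.1.
  by have := fgh x; rewrite {1}gE; lra.
have nb0 : 0 <= - b by rewrite oppr_ge0 ltW.
rewrite -mulrNN opprB mulrBr addrA lerBlDr -!nnsumZ// -!nnsumD//;
  try exact: nnsummableZ.
apply: nnsum_le; last by apply: nnsummableD => //; exact: nnsummableZ.
move=> x; apply/andP; split.
  by rewrite addr_ge0 ?fs.1// mulr_ge0// gn.1.
by have := fgh x; rewrite {1}gE; lra.
Qed.

Lemma energy_mode0 u : zero_mean u -> energy u (mode0 d) = 0.
Proof.
by move=> u0; apply: big1 => c _; rewrite u0 /sqabs/= expr0n addr0.
Qed.

(** The Leray symbol is 0 at the zero mode. The mean must stay zero because [lambda1] bounds only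
    the nonzero modes. *)
Lemma zero_mean_step u v f w s (b e : R) : zero_mean u -> zero_mean f ->
  (forall k c, w k c = specL L phi0 s u k c
     - b%:C * specL L phi1 s (Bop L v v) k c + e%:C * specL L phi1 s f k c) ->
  zero_mean w.
Proof.
move=> u0 f0 we c; rewrite we /specL u0 f0 /Bop /leray_mode lam0 eqxx.
by rewrite !mulr0 subrr addr0.
Qed.

(** One step of the scheme: u and r are the old values, w and rho the new ones, v is the
    extrapolated velocity and f the midpoint forcing. *)
Variables (nu gamma tau : R) (u v f w : @vfield R d) (r rho : R).
Hypothesis d_gt0 : (0 < d)%N.
Hypothesis d_le3 : (d <= 3)%N.
Hypothesis nu_gt0 : 0 < nu.
Hypothesis gamma_gt0 : 0 < gamma.
Hypothesis tau_gt0 : 0 < tau.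
Hypotheses (ur : regular L u) (vr : regular L v) (fs : nnsummable (energy f)).
Hypotheses (u0 : zero_mean u) (f0 : zero_mean f).
Hypothesis wE : forall k c, w k c = specL L phi0 (tau * nu) u k c
  - (tau * (1 - rho ^+ 2))%:C * specL L phi1 (tau * nu) (Bop L v v) k c
  + tau%:C * specL L phi1 (tau * nu) f k c.
Hypothesis rhoE : rho = phi0 (tau * gamma) * r + tau * (1 - rho)
  * inner L (specL L phi1 (tau * nu) (Bop L v v)) w.

Let theta := Num.min (nu * lambda1 L) gamma.
Let eps := expR (- theta * tau).
Let N (x : @vfield R d) := vol L * nnsum (energy x).

Lemma energy_decay :
  N w + (rho + 1) ^+ 2 <= eps * (N u + (r + 1) ^+ 2)
    + (1 - eps) * (theta^-1 * ((nu * lambda1 L)^-1 * N f + gamma)).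
Proof.
have l1 := lambda1_gt0 L L_gt0 d_gt0.
have nl1 : 0 < nu * lambda1 L by rewrite mulr_gt0.
have th0 : 0 < theta by rewrite lt_min nl1.
have tt : 0 < theta * tau by rewrite mulr_gt0.
have s0 : 0 < tau * nu by rewrite mulr_gt0.
have eps1 : eps <= 1 by rewrite -expR0 ler_expR mulNr oppr_le0 ltW.
have vol0 : 0 <= vol L by apply: prodr_ge0 => c _; exact: ltW.
have decay y : theta <= y -> (1 - expR (- (y * tau))) / y <= (1 - eps) / theta.
  move=> ty; have y0 : 0 < y by exact: lt_le_trans ty.
  have := one_sub_expR_le (theta * tau) (y * tau) tt.
  rewrite ler_pM2r// => /(_ ty).
  by rewrite !invfM !mulrA ler_pM2r ?invr_gt0// /eps mulNr.
have wr : regular L w := regular_step L L_gt0 _ _ _ _ _ _ _ d_le3 s0 ur vr fs wE.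
have w0 : zero_mean w := zero_mean_step _ _ _ _ _ _ _ u0 f0 wE.
pose beta := specL L phi1 (tau * nu) (Bop L v v).
have br : regular L beta by exact: regular_phi1_Bop.
(* Uniform bound for the forcing factor (1 - e) m^2: one m is paired with 1 - e and compared through
   [decay], the other is at most 1 / (nu lambda1). *)
pose kap := (1 - eps) / theta / (nu * lambda1 L).
have kap0 : 0 <= kap.
  by rewrite !mulr_ge0 ?subr_ge0// invr_ge0 ltW.
have us := regular_energy L u ur; have ws := regular_energy L w wr.
have bs := regular_energy L beta br.
have mode_le k : energy w k + 2 * (tau * (1 - rho ^+ 2)) * pairing beta w k <=
    eps * energy u k + kap * energy f k.
  have [->|k0] := eqVneq k (mode0 d).
    rewrite !energy_mode0// !mulr0 add0r addr0 /pairing big1 ?mulr0// => c _.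
    by rewrite w0 conjc0 mulr0.
  have lk := lambda1_le L k k0.
  have lk0 : 0 < lam L k by exact: lt_le_trans lk.
  set e := phi0 (tau * nu * lam L k).
  have e01 : 0 <= e <= 1.
    by rewrite ltW ?phi0_gt0//= phi0_le1// !mulr_ge0// ltW.
  have thk : theta <= nu * lam L k.
    by rewrite ge_min ler_pM2l// lk.
  have eeps : e <= eps.
    rewrite /e /phi0 ler_expR mulNr lerN2 [tau * nu]mulrC mulrAC.
    by rewrite ler_pM2r.
  (* By [phi1E], tau phi_1(tau nu lam) equals (1 - e) m, the form required by [complex_energy]. *)
  pose m := (nu * lam L k)^-1.
  have m0 : 0 <= m by rewrite invr_ge0 ltW// mulr_gt0.
  have em : (1 - e) * m ^+ 2 <= kap.
    rewrite expr2 mulrA; apply: ler_pM.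
    - by rewrite mulr_ge0// subr_ge0; case/andP: e01.
    - by [].
    - have := decay _ thk; rewrite /e /phi0 /m.
      by rewrite (_ : nu * lam L k * tau = tau * nu * lam L k)//; ring.
    - by rewrite lef_pV2 ?posrE ?mulr_gt0// ler_pM2l.
  have step c : sqabs (w k c) + 2 * (tau * (1 - rho ^+ 2)) *
      complex.Re (beta k c * conjc (w k c)) <=
      e * sqabs (u k c) + (1 - e) * m ^+ 2 * sqabs (f k c).
    apply: complex_energy => //; rewrite wE /beta /specL -/e; congr (_ + _).
    rewrite mulrA -rmorphM; congr (_%:C * _).
    rewrite /e -phi1E /m; field.
    by rewrite !gt_eqF.
  apply: (@le_trans _ _ (e * energy u k + (1 - e) * m ^+ 2 * energy f k)).
    rewrite /energy /pairing !mulr_sumr -!big_split/=.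
    by apply: ler_sum => c _; exact: step.
  by apply: lerD; rewrite ler_wpM2r ?energy_ge0.
have eps0 : 0 <= eps by exact: expR_ge0.
have total : N w + 2 * (tau * (1 - rho ^+ 2)) * inner L beta w <=
    eps * N u + kap * N f.
  have innerE : inner L beta w = vol L * ssum (pairing beta w) by [].
  have su := nnsummableZ _ _ eps0 us; have sf := nnsummableZ _ _ kap0 fs.
  have := nnsum_ssum_le _ _ _ _ _ ws (nnsummableD _ _ su sf)
    (nnsummableD _ _ bs ws) (normr_pairing_le beta w) mode_le.
  rewrite nnsumD// !nnsumZ// => /(ler_wpM2l vol0).
  by rewrite innerE /N; lra.
(* Multiplying the scalar equation by 2 (1 + rho) turns 1 - rho into 1 - rho^2, so the pairing has
   the same coefficient as in [total] and is eliminated. This is why the energy contains r + 1. *)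
have sav : 2 * rho * (1 + rho) = 2 * phi0 (tau * gamma) * r * (1 + rho) +
    2 * (tau * (1 - rho ^+ 2)) * inner L beta w.
  rewrite {1}rhoE -/beta; ring.
set a := phi0 (tau * gamma) in sav.
have a0 : 0 <= a by rewrite ltW// phi0_gt0.
have a1 : a <= 1 by rewrite phi0_le1// mulr_ge0// ltW.
have thg : theta <= gamma by rewrite ge_min lexx orbT.
have aeps : a <= eps.
  by rewrite /a /phi0 ler_expR mulNr lerN2 mulrC ler_pM2l.
have ag : 1 - a <= (1 - eps) / theta * gamma.
  by have := decay _ thg; rewrite ler_pdivrMr// [gamma * tau]mulrC.
have -> : (1 - eps) * (theta^-1 * ((nu * lambda1 L)^-1 * N f + gamma)) =
  kap * N f + (1 - eps) / theta * gamma by rewrite /kap; ring.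
(* After the elimination, a (r + 1)^2 + (1 - a) exceeds the remaining terms 1 - rho^2 + 2 a r (1 +
   rho) by exactly the quantities in [h1] and [h2]. *)
have h1 : 0 <= (1 - a) * rho ^+ 2 by rewrite mulr_ge0 ?subr_ge0// sqr_ge0.
have h2 : 0 <= a * (rho - r) ^+ 2 by rewrite mulr_ge0// sqr_ge0.
have h3 : a * (r + 1) ^+ 2 <= eps * (r + 1) ^+ 2.
  by rewrite ler_wpM2r// sqr_ge0.
lra.
Qed.

End EnergyStep.

(** * L^2 and Sobolev norms through mode energies *)

Section Norms.
Context {R : realType} {d : nat} (L : 'I_d -> R).
Hypothesis L_gt0 : forall c, 0 < L c.
Implicit Types u : @vfield R d.

Lemma in_L2_summable u : in_L2 u -> nnsummable (energy u).
Proof. by split => // k; exact: energy_ge0. Qed.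

Lemma in_Hdot_regular (a : R) u : 3 / 4 <= a -> in_Hdot L a u -> regular L u.
Proof.
move=> a34 [_ _ us].
have p1 k : 1 <= 1 + lam L k by rewrite lerDl lam_ge0.
apply: (@nnsummable_le _ _ _ (fun k => (1 + lam L k) `^ a * energy u k)).
  move=> k; rewrite mulr_ge0 ?energy_ge0 ?exprn_ge0 ?(ltW (wt_gt0 _ _))//=.
  rewrite ler_wpM2r ?energy_ge0// -powR_mulrn ?powR_ge0// -powRrM ler_powR//.
  by apply: le_trans a34; lra.
by split=> // k; rewrite mulr_ge0 ?powR_ge0 ?energy_ge0.
Qed.

Lemma sqnormE u : nnsummable (energy u) ->
  sqnorm L u = (vol L * nnsum (energy u))%:E.
Proof. by move=> us; rewrite EFinM -nnsumE. Qed.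

Lemma l2norm_sqr u : nnsummable (energy u) ->
  l2norm L u ^+ 2 = vol L * nnsum (energy u).
Proof.
move=> us; rewrite /l2norm sqnormE// sqr_sqrtr//=.
apply: mulr_ge0; first by apply: prodr_ge0 => c _; exact: ltW.
by apply: nnsum_ge0 => k; exact: energy_ge0.
Qed.

End Norms.

(** C is the fixed point of the recursion, so E - C is multiplied by at most the decay factor at
    each step and the exponents add up. *)
Lemma affine_recursion_le {R : realType} (E s : nat -> R) (C th : R) :
  0 <= C -> 0 <= E 1%N ->
  (forall n, (1 <= n)%N -> E n.+1 <= expR (- th * s n.+1) * E n
     + (1 - expR (- th * s n.+1)) * C) ->
  forall n, (1 <= n)%N ->
    E n.+1 <= expR (- th * \sum_(1 <= i < n.+1) s i.+1) * E 1%N + C.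
Proof.
move=> C0 E0 step n n1.
suff : E n.+1 - C <= expR (- th * \sum_(1 <= i < n.+1) s i.+1) * (E 1%N - C).
  have : 0 <= expR (- th * \sum_(1 <= i < n.+1) s i.+1) * C.
    by rewrite mulr_ge0// expR_ge0.
  lra.
elim: n n1 => // n IH _; case: n => [|n] in IH *.
  by rewrite big_nat1; have := step 1%N isT; lra.
rewrite big_nat_recr//= [X in expR X]mulrDr expRD.
have := ler_wpM2l (expR_ge0 (- th * s n.+3)) (IH isT).
by have := step n.+2 isT; lra.
Qed.

Theorem theorem1 (R : realType) (d : nat) (L : 'I_d -> R) (nu gamma alpha : R)
    (F : R -> vfield d) (t : nat -> R) (u : nat -> vfield d) (r : nat -> R) :
  (d = 2 \/ d = 3)%N ->
  (forall c, 0 < L c) -> 0 < nu -> 0 < gamma ->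
  (* F in L^oo(0,oo; H) *)
  (forall s, 0 < s -> in_H L (F s)) ->
  (exists M : R, forall s, 0 < s -> l2norm L (F s) <= M) ->
  (* time nodes 0 = t_0 < t_1 < t_2 < ... *)
  t 0%N = 0 -> (forall k, t k < t k.+1) ->
  (* initial data *)
  3 / 4 <= alpha ->
  (forall i, (i <= 1)%N -> in_Hdot L alpha (u i) /\ in_H L (u i)) ->
  (* the ETD-mr-SAV-MS2o scheme *)
  (forall n, (1 <= n)%N ->
     let tau := fun k => t k - t k.-1 in
     let ut : vfield d := fun m c =>
       ((tau n.+1 + 2 * tau n) / (2 * tau n))%:C * u n m c
       - (tau n.+1 / (2 * tau n))%:C * u n.-1 m c in
     let Bt := Bop L ut ut in
     let Fh := F (t n + tau n.+1 / 2) in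
     (forall m c, u n.+1 m c =
        specL L phi0 (tau n.+1 * nu) (u n) m c
        - (tau n.+1 * (1 - r n.+1 ^+ 2))%:C * specL L phi1 (tau n.+1 * nu) Bt m c
        + (tau n.+1)%:C * specL L phi1 (tau n.+1 * nu) Fh m c) /\
     r n.+1 = phi0 (tau n.+1 * gamma) * r n
              + tau n.+1 * (1 - r n.+1)
                * inner L (specL L phi1 (tau n.+1 * nu) Bt) (u n.+1)) ->
  let tau := fun k => t k - t k.-1 in
  let theta := Num.min (nu * lambda1 L) gamma in
  let FLinf := sup [set l2norm L (F s) | s in [set s : R | 0 < s]] in
  forall n, (1 <= n)%N ->
    (sqnorm L (u n.+1) + ((r n.+1 + 1) ^+ 2)%:E
     <= (expR (- theta * \sum_(1 <= i < n.+1) tau i.+1))%:E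
          * (sqnorm L (u 1%N) + ((r 1%N + 1) ^+ 2)%:E)
        + (theta^-1 * ((nu * lambda1 L)^-1 * FLinf ^+ 2 + gamma))%:E)%E.
Proof.
move=> d23 L0 nu0 g0 FH [M FM] t0 tS a34 u01 scheme tau theta FLinf.
have d0 : (0 < d)%N by case: d23 => ->.
have d3 : (d <= 3)%N by case: d23 => ->.
have tau0 n : 0 < tau n.+1 by rewrite subr_gt0.
have t_ge0 n : 0 <= t n.
  by elim: n => [|n IH]; rewrite ?t0// (le_trans IH)// ltW.
pose Fh n := F (t n + tau n.+1 / 2).
(* The assumptions on F concern positive times only, and the midpoint is positive even for n = 0. *)
have Fh_gt0 n : 0 < t n + tau n.+1 / 2 by rewrite ltr_wpDl// divr_gt0.
have Fs n : nnsummable (energy (Fh n)).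
  by apply: in_L2_summable; have [_ _ _] := FH _ (Fh_gt0 n).
have F0 n : zero_mean (Fh n) by have [_] := FH _ (Fh_gt0 n).
pose ut n : vfield d := fun m c =>
  ((tau n.+1 + 2 * tau n) / (2 * tau n))%:C * u n m c
  - (tau n.+1 / (2 * tau n))%:C * u n.-1 m c.
have uE n : (1 <= n)%N -> forall m c, u n.+1 m c =
    specL L phi0 (tau n.+1 * nu) (u n) m c
    - (tau n.+1 * (1 - r n.+1 ^+ 2))%:C
      * specL L phi1 (tau n.+1 * nu) (Bop L (ut n) (ut n)) m c
    + (tau n.+1)%:C * specL L phi1 (tau n.+1 * nu) (Fh n) m c.
  by move=> n1; have [] := scheme n n1.
have rE n : (1 <= n)%N -> r n.+1 = phi0 (tau n.+1 * gamma) * r n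
    + tau n.+1 * (1 - r n.+1)
      * inner L (specL L phi1 (tau n.+1 * nu) (Bop L (ut n) (ut n))) (u n.+1).
  by move=> n1; have [] := scheme n n1.
have s0 n : 0 < tau n.+1 * nu by rewrite mulr_gt0.
have utR n : regular L (u n.-1) -> regular L (u n) -> regular L (ut n).
  by move=> r1 r2; apply: (regular_comb L _ _ _ _ _ r2 r1).
(* Two consecutive levels are carried along because the extrapolated velocity uses both. *)
have reg n : regular L (u n) /\ regular L (u n.+1).
  elim: n => [|n [rn rn1]].
    by split; apply: in_Hdot_regular a34 _; [have [] := u01 0%N isT|have [] := u01 1%N isT].
  split=> //; apply: (regular_step L L0 _ _ _ _ _ _ _ d3 (s0 n.+1) rn1
    (utR n.+1 rn rn1) (Fs n.+1) (uE n.+1 isT)).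
have zm n : zero_mean (u n.+1).
  elim: n => [|n IH]; first by have [_ []] := u01 1%N isT.
  exact: (zero_mean_step L _ _ _ _ _ _ _ IH (F0 n.+1) (uE n.+1 isT)).
pose N (x : vfield d) := vol L * nnsum (energy x).
have vol0 : 0 <= vol L by apply: prodr_ge0 => c _; exact: ltW.
have N0 x : 0 <= N x.
  by rewrite mulr_ge0// nnsum_ge0// => k; exact: energy_ge0.
have FN n : N (Fh n) <= FLinf ^+ 2.
  rewrite /N -(l2norm_sqr L L0 _ (Fs n)).
  have ub : l2norm L (Fh n) <= FLinf.
    (* The uniform bound [M] makes the supremum an actual upper bound. *)
    apply: ub_le_sup; last by exists (t n + tau n.+1 / 2); first exact: Fh_gt0.
    by exists M => _ [s s_gt0 <-]; exact: FM.
  by rewrite lerXn2r ?nnegrE ?sqrtr_ge0// (le_trans _ ub)// sqrtr_ge0.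
have nl0 : 0 < nu * lambda1 L by rewrite mulr_gt0// lambda1_gt0.
have th0 : 0 < theta by rewrite lt_min nl0.
pose E n := N (u n) + (r n + 1) ^+ 2.
pose C := theta^-1 * ((nu * lambda1 L)^-1 * FLinf ^+ 2 + gamma).
have nli0 : 0 <= (nu * lambda1 L)^-1 by rewrite invr_ge0 ltW.
have thi0 : 0 <= theta^-1 by rewrite invr_ge0 ltW.
have C0 : 0 <= C.
  by rewrite mulr_ge0// addr_ge0 ?(ltW g0)// mulr_ge0// sqr_ge0.
have step n : (1 <= n)%N -> E n.+1 <= expR (- theta * tau n.+1) * E n
     + (1 - expR (- theta * tau n.+1)) * C.
  case: n => // n _.
  have [rn rn1] := reg n.
  have := energy_decay L L0 nu gamma (tau n.+2) (u n.+1) (ut n.+1) (Fh n.+1)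
    (u n.+2) (r n.+1) (r n.+2) d0 d3 nu0 g0 (tau0 _) rn1 (utR n.+1 rn rn1)
    (Fs n.+1) (zm n) (F0 n.+1) (uE n.+1 isT) (rE n.+1 isT).
  move/le_trans; apply; rewrite lerD2l ler_wpM2l//.
    by rewrite subr_ge0 -expR0 ler_expR mulNr oppr_le0 mulr_ge0 ?ltW.
  by rewrite ler_wpM2l// lerD2r ler_wpM2l// FN.
move=> n n1; have us k := regular_energy L (u k) (reg k).1.
(* By regularity the squared norms are finite, which reduces the claim to an inequality between
   reals. *)
rewrite (sqnormE L _ (us n.+1)) (sqnormE L _ (us 1%N)) -!EFinD lee_fin.
apply: (affine_recursion_le E tau C theta) => //.
by rewrite addr_ge0 ?N0 ?sqr_ge0.
Qed.
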